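(* Let $L/K$ be a Galois extension and let $F$ be an intermediate field, $K\subseteq F\subseteq L$, with $F/K$ finite. For any $F$-rational quiver $\Gamma_F$ (with respect to $L/F$) and any $K$-rational quiver $\Gamma'_K$ (with respect to $L/K$) there is a natural isomorphism \[ \operatorname{Hom}_F(\Gamma_F,F\otimes_K\Gamma'_K)\cong\operatorname{Hom}_K(\operatorname{Res}_{F/K}\Gamma_F,\Gamma'_K). \]
   Context: A quiver is $\Gamma=(V,E,s,t)$ with finite sets $V,E$ and maps $s,t\colon E\to V$. A $K$-rational quiver with respect to a Galois extension $L/K$ is a quiver with continuous left actions of $\operatorname{Gal}(L/K)$ (profinite topology) on the discrete sets $V$ and $E$ such that $s,t$ are equivariant; similarly for $F$ with $\operatorname{Gal}(L/F)$. $\operatorname{Hom}_K$ (resp. $\operatorname{Hom}_F$) denotes the set of morphisms of quivers (pairs of maps on vertices and edges compatible with $s$ and $t$) commuting with the Galois actions. Base change: $F\otimes_K\Gamma'_K$ is the same quiver with the action restricted to $\operatorname{Gal}(L/F)$. Restriction: for $\Gamma_F$ with underlying quiver $(V,E,s,t)$, \[ \operatorname{Res}_{F/K}\Gamma_F=\bigl(\operatorname{Gal}(L/K)\times_{\operatorname{Gal}(L/F)}V,\ \operatorname{Gal}(L/K)\times_{\operatorname{Gal}(L/F)}E,\ \operatorname{Gal}(L/K)\times_{\operatorname{Gal}(L/F)}s,\ \operatorname{Gal}(L/K)\times_{\operatorname{Gal}(L/F)}t\bigr), \] where for a group $G$, subgroup $H$ and $H$-set $Z$, $G\times_HZ$ is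 the quotient of $G\times Z$ by $(gh,z)\sim(g,hz)$, with $G$ acting by left multiplication on the first factor. *)

(* Defs.v *)
From HB Require Import structures.
From mathcomp Require Import all_boot all_order all_algebra all_field.
From mathcomp Require Import finmap boolp classical_sets functions cardinality.
From mathcomp Require Import filter topology.

Set Implicit Arguments.
Unset Strict Implicit.
Unset Printing Implicit Defensive.

Import GRing.Theory.

Local Open Scope classical_set_scope.
Local Open Scope ring_scope.
Local Open Scope quotient_scope.

(* A field extension L/k is an embedding j : {rmorphism k -> L}; L/k may be   *)
(* infinite, so MathComp's finite-dimensional notion galois does not apply.   *)

Section GaloisExtension.
Variables (k L : fieldType) (j : {rmorphism k -> L}).

Definition algebraic_ext := forall x : L, algebraicOver j x.

(* An irreducible p : {poly k} with root x is, up to a scalar, the minimal    *)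
(* polynomial of x over k.                                                    *)
Definition separable_ext := forall (p : {poly k}) (x : L),
  irreducible_poly p -> root (map_poly j p) x -> separable_poly p.

Definition normal_ext := forall (p : {poly k}) (x : L),
  irreducible_poly p -> root (map_poly j p) x ->
  exists rs : seq L, map_poly j p %= \prod_(r <- rs) ('X - r%:P).

Definition galois_ext := [/\ algebraic_ext, separable_ext & normal_ext].

End GaloisExtension.

(* The product of Gal(L/k) is composition: (s * t) x = s (t x).               *)

Record galois_group (k L : fieldType) (j : {rmorphism k -> L}) := GaloisGroup {
  gal_val :> {rmorphism L -> L};
  gal_bij : bijective gal_val;
  gal_fix : forall a : k, gal_val (j a) = j a }.

Section GaloisGroupTheory.
Variables (k L : fieldType) (j : {rmorphism k -> L}).

Lemma rmorphism_ext (R S : nzRingType) (f g : {rmorphism R -> S}) :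
  f =1 g -> f = g.
Proof.
case: f g => [f cf] [g cg] /= /funext fg; case: _ / fg in cg *.
congr (GRing.RMorphism.Pack _); case: cf cg => [[[a1 a2]] [b]] [[[c1 c2]] [d]].
by congr (GRing.RMorphism.Class _ _); congr (_ _); exact: Prop_irrelevance.
Qed.

Lemma gal_ext (s t : galois_group j) : s =1 t -> s = t.
Proof.
case: s t => [s sb sf] [t tb tf] /= /rmorphism_ext st.
by case: _ / st in tb tf *; congr GaloisGroup; exact: Prop_irrelevance.
Qed.

HB.instance Definition _ := gen_eqMixin (galois_group j).
HB.instance Definition _ := gen_choiceMixin (galois_group j).

Definition gal_one : galois_group j :=
  @GaloisGroup _ _ j (idfun : {rmorphism L -> L})
    (Bijective (frefl _) (frefl _)) (fun=> erefl).

Program Definition gal_mul (s t : galois_group j) : galois_group j :=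
  @GaloisGroup _ _ j (s \o t : {rmorphism L -> L})
    (bij_comp (gal_bij s) (gal_bij t)) _.
Next Obligation. by move=> s t a; rewrite /= !gal_fix. Qed.

Lemma gal_inv_subproof (s : galois_group j) :
  exists t : galois_group j, cancel s t /\ cancel t s.
Proof.
have [f sK fK] := gal_bij s.
pose f' : {rmorphism L -> L} := HB.pack f
  (GRing.isZmodMorphism.Build _ _ f (can2_zmod_morphism sK fK))
  (GRing.isMonoidMorphism.Build _ _ f (can2_monoid_morphism sK fK)).
have ff a : f' (j a) = j a by rewrite -[in LHS](gal_fix s) /= sK.
by exists (@GaloisGroup _ _ j f' (Bijective fK sK) ff).
Qed.

Definition gal_inv (s : galois_group j) : galois_group j :=
  projT1 (cid (gal_inv_subproof s)).

Lemma gal_invK (s : galois_group j) : cancel s (gal_inv s).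
Proof. by rewrite /gal_inv; case: cid => t []. Qed.

Lemma gal_invVK (s : galois_group j) : cancel (gal_inv s) s.
Proof. by rewrite /gal_inv; case: cid => t []. Qed.

Lemma gal_mulA : associative gal_mul. Proof. by move=> *; exact: gal_ext. Qed.
Lemma gal_mul1 : left_id gal_one gal_mul.
Proof. by move=> *; exact: gal_ext. Qed.
Lemma gal_mulr1 : right_id gal_one gal_mul.
Proof. by move=> *; exact: gal_ext. Qed.
Lemma gal_mulV : left_inverse gal_one gal_inv gal_mul.
Proof. by move=> s; apply: gal_ext => x /=; rewrite gal_invK. Qed.
Lemma gal_mulrV : right_inverse gal_one gal_inv gal_mul.
Proof. by move=> s; apply: gal_ext => x /=; rewrite gal_invVK. Qed.

HB.instance Definition _ := isGroup.Build (galois_group j)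
  gal_mulA gal_mul1 gal_mulr1 gal_mulV gal_mulrV.

(* The cosets of the subgroups Gal(L/M), for M a finite extension of k        *)
(* embedded in L over k, generate the profinite (Krull) topology.             *)
Definition gal_cosets : set_system (galois_group j) := [set A |
  exists (M : fieldExtType k) (m : {rmorphism M -> L}) (s : galois_group j),
    (forall a : k, m (a%:A) = j a) /\
    A = [set t : galois_group j | forall x : M, t (m x) = s (m x)]].

HB.instance Definition _ :=
  isSubBaseTopological.Build (galois_group j) gal_cosets id.

Lemma galM (s t : galois_group j) x : (s * t)%g x = s (t x). Proof. by []. Qed.
Lemma gal1 x : (1%g : galois_group j) x = x. Proof. by []. Qed.
Lemma galK (s : galois_group j) : cancel s (s^-1)%g.
Proof. exact: gal_invK. Qed.
Lemma galVK (s : galois_group j) : cancel (s^-1)%g s.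
Proof. exact: gal_invVK. Qed.

Lemma fieldExt_algebraic (M : fieldExtType k) (m : {rmorphism M -> L}) (x : M) :
  (forall a : k, m (a%:A) = j a) -> algebraicOver j (m x).
Proof.
move=> mj; have /polyOver1P[p pE] := minPolyOver 1 x.
exists p.
  by rewrite -(map_poly_eq0 (in_alg M)) -pE monic_neq0 // monic_minPoly.
have -> : map_poly j p = map_poly m (map_poly (in_alg M) p).
  by rewrite -map_poly_comp; apply: eq_map_poly => a /=; rewrite mj.
by rewrite -pE fmorph_root root_minPoly.
Qed.

Lemma simple_fieldExt (x : L) : algebraicOver j x ->
  exists (M : fieldExtType k) (m : {rmorphism M -> L}),
    (forall a : k, m (a%:A) = j a) /\ exists y, m y = x.
Proof.
case=> p0 p0n0 p0x.
pose P n := `[< exists p, [/\ p != 0, root (map_poly j p) x & size p = n] >].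
have exP : exists n, P n by exists (size p0); apply/asboolP; exists p0.
case: (ex_minnP exP) => n /asboolP[p [pn0 px pn]] minn.
have irr : irreducible_poly p.
  apply/(subfx_irreducibleP px pn0) => q qx qn0; rewrite pn.
  by apply: minn; apply/asboolP; exists q.
exists (SubFieldExtType px irr), (subfx_inj : {rmorphism subFExtend j x p -> L}).
split; first by move=> a; exact: subfx_inj_base.
by exists (subfx_root j x p); exact: subfx_inj_root.
Qed.

Lemma coset_open (A : set (galois_group j)) : gal_cosets A -> open A.
Proof.
move=> hA; exists [set A]; last by rewrite bigcup_set1.
move=> _ ->; exists [fset A]%fset.
  by move=> B; rewrite !inE => ->.
rewrite predeqE => t; split => [|tA B]; first by apply; rewrite /= inE.
by rewrite /= inE => /eqP ->.
Qed.

Lemma nbhs_galP (s : galois_group j) (A : set (galois_group j)) : nbhs s A <->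
  exists2 xs : seq L, {in xs, forall x, algebraicOver j x} &
    forall t : galois_group j, {in xs, t =1 s} -> A t.
Proof.
split=> [|[xs]].
  rewrite nbhsE => -[B [[D DB UB] sB] BA]; rewrite -UB in sB BA.
  case: sB => U DU Us; have [D' D'D D'U] := DB _ DU.
  have {BA} : U `<=` A by move=> t Ut; apply: BA; exists U.
  rewrite -D'U in Us *.
  have H : forall V, V \in (D' : seq _) -> gal_cosets V /\ V s.
    by move=> V VD'; split; [have /set_mem := D'D _ VD' | exact: Us].
  move=> sub; rewrite /= in H sub; move=> {U DU Us D'D D'U B D DB UB}.
  suff [xs algxs hxs] : exists2 xs : seq L,
      {in xs, forall x, algebraicOver j x} &
      forall t : galois_group j, {in xs, t =1 s} ->
        forall B, B \in (D' : seq _) -> B t.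
    by exists xs => // t ts; apply: sub => B /=; exact: hxs.
  elim: (D' : seq _) H => [_|B r IH H]; first by exists [::].
  have [|xs algxs hxs] := IH.
    by move=> C Cr; apply: H; rewrite inE Cr orbT.
  have [[M [m [u [mj BE]]]] Bs] := H B (mem_head _ _).
  exists (map m (vbasis {:M}) ++ xs).
    move=> x; rewrite mem_cat => /orP[/mapP[y _ ->]|/algxs//].
    exact: fieldExt_algebraic.
  move=> t ts C; rewrite inE => /orP[/eqP ->|]; last first.
    by apply: hxs => x xxs; apply: ts; rewrite mem_cat xxs orbT.
  rewrite BE in Bs *; move=> y; rewrite -Bs (coord_vbasis (memvf y)).
  rewrite !rmorph_sum /=; apply: eq_bigr => i _.
  have mZ c v : m (c *: v) = j c * m v by rewrite -mulr_algl rmorphM /= mj.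
  rewrite !mZ !rmorphM !gal_fix ts // mem_cat; apply/orP; left.
  by rewrite map_f // mem_nth // size_tuple.
elim: xs A => [A _ hA|x xs IH A algx hA].
  by have -> : A = setT; [rewrite -subTset => t _; exact: hA|exact: filterT].
have [M [m [mj [y yx]]]] := simple_fieldExt (algx x (mem_head _ _)).
pose B := [set t : galois_group j | forall x, t (m x) = s (m x)].
pose C := [set t : galois_group j | {in xs, t =1 s}].
apply: (@filterS _ _ _ (B `&` C)).
  move=> t [Bt Ct]; apply: hA => z; rewrite inE => /orP[/eqP ->|/Ct//].
  by rewrite -yx Bt.
apply: filterI.
  by apply: open_nbhs_nbhs; split => //; apply: coset_open; exists M, m, s.
by apply: IH => // z zxs; apply: algx; rewrite inE zxs orbT.
Qed.

End GaloisGroupTheory.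

Record laction (G : groupType) (Z : Type) := LAction {
  lact :> G -> Z -> Z;
  lact1 : forall z, lact 1%g z = z;
  lactM : forall g h z, lact (g * h)%g z = lact g (lact h z) }.

Definition continuous_laction (k L : fieldType) (j : {rmorphism k -> L})
    (Z : choiceType) (a : laction (galois_group j) Z) :=
  continuous (fun p : galois_group j * discrete_topology Z =>
    a p.1 p.2 : discrete_topology Z).

Lemma continuous_lactionP (k L : fieldType) (j : {rmorphism k -> L})
    (Z : choiceType) (a : laction (galois_group j) Z) :
  continuous_laction a <->
  forall s z, nbhs s [set t | a t z = a s z].
Proof.
have nbhs_disc (z : discrete_topology Z) : nbhs z [set z].
  exact: (@discrete_set1 (discrete_topology Z)).
split=> [ca s z|ca [s z] /=].
  have /= := ca (s, z) _ (nbhs_disc (a s z)).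
  case=> -[U V] /= [Us Vz] UV; apply: filterS Us => t Ut.
  suff /UV : (U `*` V) (t, z) by [].
  by split => //=; exact: (@nbhs_singleton (discrete_topology Z)).
apply/(@discrete_cvg (discrete_topology Z)) => /=.
exists ([set t | a t z = a s z], [set z]) => /=; first by split.
by case=> t w /= [tz ->].
Qed.

Section BalancedProduct.
Variables (H G : groupType) (i : {multiplicative H -> G}) (Z : choiceType).
Variable a : laction H Z.

Definition restrict_laction (Y : Type) (b : laction G Y) : laction H Y.
Proof.
exists (fun h => b (i h)) => [z|g h z].
  suff -> : i 1%g = 1%g by exact: lact1.
  by apply: (mulgI (i 1%g)); rewrite -gmulfM !mulg1.
by rewrite gmulfM lactM.
Defined.

(* (g h, z) ~ (g, h z)                                                        *)
Definition balanced_rel : rel (G * Z) := fun x y =>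
  `[< exists h : H, x.1 = (y.1 * i h)%g /\ y.2 = a h x.2 >].

Lemma balanced_rel_equiv : equiv_class_of balanced_rel.
Proof.
have i1 : i 1%g = 1%g.
  by apply: (mulgI (i 1%g)); rewrite -gmulfM !mulg1.
split=> [x|x y|y x z].
- by apply/asboolP; exists 1%g; rewrite i1 mulg1 lact1.
- apply/idP/idP => /asboolP[h [e1 e2]]; apply/asboolP; exists h^-1%g.
    by rewrite e1 e2 -mulgA -gmulfM mulgV i1 mulg1 -lactM mulVg lact1.
  by rewrite e1 e2 -mulgA -gmulfM mulgV i1 mulg1 -lactM mulVg lact1.
- move=> /asboolP[h [e1 e2]] /asboolP[h' [e1' e2']]; apply/asboolP.
  by exists (h' * h)%g; rewrite e1 e1' e2' e2 lactM gmulfM mulgA.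
Qed.

Canonical balanced_equiv := EquivRelPack balanced_rel_equiv.

Definition balanced := {eq_quot balanced_equiv}.

HB.instance Definition _ := Choice.on balanced.
HB.instance Definition _ := EqQuotient.on balanced.

Lemma balancedP (x y : G * Z) :
  reflect (exists h : H, x.1 = (y.1 * i h)%g /\ y.2 = a h x.2)
    (\pi_balanced x == \pi_balanced y).
Proof. by rewrite eqmodE; exact: asboolP. Qed.

Definition balanced_act (g : G) (q : balanced) : balanced :=
  \pi_balanced ((g * (repr q).1)%g, (repr q).2).

Lemma balanced_actE g x :
  balanced_act g (\pi_balanced x) = \pi_balanced ((g * x.1)%g, x.2).
Proof.
apply/eqP/balancedP => /=.
have /eqP/balancedP[h [e1 e2]] := reprK (\pi_balanced x).
by exists h; rewrite e1 e2 mulgA.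
Qed.

Definition balanced_laction : laction G balanced.
Proof.
exists balanced_act => [|g h] q; elim/quotW: q => -[u z].
  by rewrite balanced_actE mul1g.
by rewrite (balanced_actE h (u, z)) !balanced_actE /= mulgA.
Defined.

End BalancedProduct.

Arguments balanced {H G} i {Z} a.

Section BalancedMap.
Variables (H G : groupType) (i : {multiplicative H -> G}).
Variables (Y Z : choiceType) (a : laction H Y) (b : laction H Z) (f : Y -> Z).

Definition balanced_map (q : balanced i a) : balanced i b :=
  \pi_(balanced i b) ((repr q).1, f (repr q).2).

Hypothesis fE : forall h y, f (a h y) = b h (f y).

Lemma balanced_mapE x :
  balanced_map (\pi_(balanced i a) x) = \pi_(balanced i b) (x.1, f x.2).
Proof.
apply/eqP/balancedP => /=.
have /eqP/balancedP[h [e1 e2]] := reprK (\pi_(balanced i a) x).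
by exists h; rewrite e1 e2 fE.
Qed.

Lemma balanced_map_act g q :
  balanced_map (balanced_laction i a g q) =
  balanced_laction i b g (balanced_map q).
Proof.
by elim/quotW: q => x; rewrite /= balanced_actE !balanced_mapE balanced_actE.
Qed.

End BalancedMap.

Arguments balanced_map {H G} i {Y Z} a b f.

(* An intermediate field of L/K that is finite over K is a fieldExtType F     *)
(* over K with an embedding iota of F into L.                                 *)
Section IntermediateField.
Variables (K : fieldType) (F : fieldExtType K) (L : fieldType).
Variable iota : {rmorphism F -> L}.

Definition base_embedding : {rmorphism K -> L} := iota \o in_alg F.

Lemma gal_incl_subproof (s : galois_group iota) a :
  s (base_embedding a) = base_embedding a.
Proof. exact: gal_fix. Qed.

Definition gal_incl (s : galois_group iota) : galois_group base_embedding :=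
  GaloisGroup (gal_bij s) (gal_incl_subproof s).

Lemma gal_incl_mul : {morph gal_incl : s t / (s * t)%g}.
Proof. by move=> s t; exact: gal_ext. Qed.

HB.instance Definition _ :=
  isMultiplicative.Build (galois_group iota) (galois_group base_embedding)
    gal_incl gal_incl_mul.

Lemma gal_inclP (s : galois_group base_embedding) :
  (forall x : F, s (iota x) = iota x) -> exists t, s = gal_incl t.
Proof. by move=> fs; exists (GaloisGroup (gal_bij s) fs); exact: gal_ext. Qed.

Lemma algebraic_base (x : L) :
  algebraicOver base_embedding x -> algebraicOver iota x.
Proof.
case=> p pn0 px; exists (map_poly (in_alg F) p); first by rewrite map_poly_eq0.
by rewrite -map_poly_comp.
Qed.

Lemma algebraic_tower (x : L) :
  algebraicOver iota x -> algebraicOver base_embedding x.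
Proof.
move=> /integral_algebraic[p pm px]; apply/integral_algebraic.
apply: (integral_root_monic (p := map_poly iota p)) => //.
  by rewrite map_monic.
move=> y /(nthP 0)[n _ <-]; rewrite coef_map; apply/integral_algebraic.
exact: fieldExt_algebraic.
Qed.

Lemma restrict_continuous (Z : choiceType)
    (a : laction (galois_group base_embedding) Z) :
  continuous_laction a -> continuous_laction (restrict_laction gal_incl a).
Proof.
move=> /continuous_lactionP ca; apply/continuous_lactionP => s z /=.
have /nbhs_galP[xs algxs hxs] := ca (gal_incl s) z.
apply/nbhs_galP; exists xs; first by move=> x /algxs; exact: algebraic_base.
by move=> t ts; exact: hxs.
Qed.

Let bF : seq F := vbasis {:F}.

Let gal_fixF (s t : galois_group base_embedding) :
  {in bF, forall x, s (iota x) = t (iota x)} ->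
  forall x, s (iota x) = t (iota x).
Proof.
move=> st x; rewrite (coord_vbasis (memvf x)) !rmorph_sum /=.
apply: eq_bigr => i _.
have mZ c v : iota (c *: v) = base_embedding c * iota v.
  by rewrite -mulr_algl rmorphM.
by rewrite !mZ !rmorphM !gal_fix st // mem_nth // size_tuple.
Qed.

Lemma balanced_continuous (Z : choiceType) (a : laction (galois_group iota) Z) :
  continuous_laction a -> continuous_laction (balanced_laction gal_incl a).
Proof.
move=> /continuous_lactionP ca; apply/continuous_lactionP => s q.
elim/quotW: q => -[g z]; have /nbhs_galP[xs algxs hxs] := ca 1%g z.
apply/nbhs_galP; exists (map g (xs ++ map iota bF)).
  have algg x : algebraicOver base_embedding x ->
      algebraicOver base_embedding (g x).
    case=> p pn0 px; exists p => //.
    have -> : map_poly base_embedding p = map_poly g (map_poly base_embedding p).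
      by rewrite -map_poly_comp; apply: eq_map_poly => c /=; rewrite gal_fix.
    by rewrite fmorph_root.
  move=> _ /mapP[x + ->]; rewrite mem_cat => /orP[/algxs/algebraic_tower/algg//|].
  case/mapP => y _ ->; apply: algg; exact: fieldExt_algebraic.
move=> t ts; rewrite /= !balanced_actE /=.
pose u := ((s * g)^-1 * (t * g))%g.
have uE x : x \in xs ++ map iota bF -> u x = x.
  move=> xin; rewrite /u galM galM ts ?map_f //.
  by rewrite -[s (g x)]galM galK.
have [h uh] : exists h, u = gal_incl h.
  apply: gal_inclP; apply: (@gal_fixF u 1%g) => x xb.
  by rewrite uE // mem_cat map_f // orbT.
apply/eqP/balancedP => /=; exists h; split.
  by rewrite -uh /u mulVKg.
rewrite -[LHS](lact1 a); apply/esym/hxs => x xin.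
have : gal_incl h x = x by rewrite -uh uE // mem_cat xin.
by [].
Qed.

Let roots_seq (p : {poly L}) :
  p != 0 -> exists rs : seq L, forall x, root p x -> x \in rs.
Proof.
elim: (size p) {-2}p (leqnn (size p)) => [{}p|n IH {}p szp pn0].
  by rewrite leqn0 size_poly_eq0 => ->.
have [[x px]|nroot] := pselect (exists x, root p x); last first.
  by exists [::] => x px; case: nroot; exists x.
have /factor_theorem[q pq] := px.
have qn0 : q != 0 by apply: contraNneq pn0 => q0; rewrite pq q0 mul0r.
have [|rs hrs] := IH q _ qn0.
  by move: szp; rewrite pq size_Mmonic ?monicXsubC // size_XsubC addn2.
exists (x :: rs) => y; rewrite pq rootM root_XsubC inE => /orP[/hrs ->|->//].
by rewrite orbT.
Qed.

Let conjugates_seq (x : F) : exists rs : seq L,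
  forall s : galois_group base_embedding, s (iota x) \in rs.
Proof.
have [p pn0 px] := fieldExt_algebraic (j := base_embedding) (m := iota) x
  (fun=> erefl).
have [|rs hrs] := @roots_seq (map_poly base_embedding p).
  by rewrite map_poly_eq0.
exists rs => s; apply: hrs.
have -> : map_poly base_embedding p = map_poly s (map_poly base_embedding p).
  by rewrite -map_poly_comp; apply: eq_map_poly => c /=; rewrite gal_fix.
by rewrite fmorph_root.
Qed.

Lemma gal_incl_fin : exists (I : finType)
    (c : galois_group base_embedding -> I),
  forall s t, c s = c t -> exists h, s = (t * gal_incl h)%g.
Proof.
have [rs hrs] : exists rs : seq L,
    forall (s : galois_group base_embedding) x, x \in bF -> s (iota x) \in rs.
  elim: bF => [|x xs [rs hrs]]; first by exists [::].
  have [rs' hrs'] := conjugates_seq x.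
  exists (rs' ++ rs) => s y; rewrite inE mem_cat => /orP[/eqP ->|/hrs ->].
    by rewrite hrs'.
  by rewrite orbT.
exists {ffun 'I_(size bF) -> 'I_(size rs).+1}.
exists (fun s => [ffun k : 'I_(size bF) => inord (index (s (iota bF`_k)) rs)]).
move=> s t /ffunP st.
have {}st : {in bF, forall x, s (iota x) = t (iota x)}.
  move=> x xb; have kb : (index x bF < size bF)%N by rewrite index_mem.
  have := st (Ordinal kb); rewrite !ffunE /= nth_index // => /(congr1 val) /=.
  rewrite !inordK ?ltnS ?index_size // => /(congr1 (nth 0 rs)).
  by rewrite !nth_index ?hrs.
have [h hE] : exists h, (t^-1 * s)%g = gal_incl h.
  by apply: gal_inclP => x; rewrite galM (gal_fixF st) galK.
by exists h; rewrite -hE mulVKg.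
Qed.

Lemma balanced_finite (Z : finType) (a : laction (galois_group iota) Z) :
  finite_set [set: balanced gal_incl a].
Proof.
have [I [c hc]] := gal_incl_fin.
pose rep (i : I) : galois_group base_embedding :=
  if pselect (exists s, c s = i) is left ex then projT1 (cid ex) else 1%g.
apply: (@sub_finite_set _ _
  ((fun x => \pi_(balanced gal_incl a) (rep x.1, x.2)) @` [set: I * Z])).
  move=> q _; elim/quotW: q => -[s z].
  have : c s = c (rep (c s)).
    by rewrite /rep; case: pselect => [ex|[]]; [case: cid|exists s].
  case/hc => h sE; exists (c s, a h z) => //=.
  by apply/esym/eqP/balancedP; exists h.
by apply: finite_image; exact: finite_finset.
Qed.

End IntermediateField.

Section BalancedFinite.
Variables (K : fieldType) (F : fieldExtType K) (L : fieldType).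
Variables (iota : {rmorphism F -> L}) (Z : finType).
Variable a : laction (galois_group iota) Z.
Local Notation Q := (balanced (@gal_incl _ _ _ iota) a).

Lemma balanced_enum_subproof : exists e : seq Q, Finite.axiom e.
Proof.
have /finite_seqP[e eE] := balanced_finite a.
exists (undup e); apply: Finite.uniq_enumP; first exact: undup_uniq.
by move=> x; rewrite mem_undup; have : [set: Q] x by []; rewrite eE.
Qed.

Let e : seq Q := projT1 (cid balanced_enum_subproof).
Let eP : Finite.axiom e := projT2 (cid balanced_enum_subproof).

Let balanced_pickleK : pcancel (index^~ e) (onth e).
Proof.
move=> x; have xe : x \in e by rewrite -has_pred1 has_count eP.
by rewrite onthE -(index_map Some_inj) nth_index ?map_f.
Qed.

Definition balanced_finType : finType :=
  HB.pack Q (isCountable.Build Q balanced_pickleK) (isFinite.Build Q eP).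

End BalancedFinite.

Record quiver := Quiver {
  vert : finType;
  edge : finType;
  src : edge -> vert;
  tgt : edge -> vert }.

(* A k-rational quiver with respect to the extension j : k -> L.              *)
Record rquiver (k L : fieldType) (j : {rmorphism k -> L}) := RQuiver {
  rq_quiver :> quiver;
  vact : laction (galois_group j) (vert rq_quiver);
  eact : laction (galois_group j) (edge rq_quiver);
  vact_continuous : continuous_laction vact;
  eact_continuous : continuous_laction eact;
  src_act : forall g e, src (eact g e) = vact g (src e);
  tgt_act : forall g e, tgt (eact g e) = vact g (tgt e) }.

Record rquiver_hom (k L : fieldType) (j : {rmorphism k -> L})
    (A B : rquiver j) := RQuiverHom {
  hom_vert : vert A -> vert B;
  hom_edge : edge A -> edge B;
  hom_src : forall e, src (hom_edge e) = hom_vert (src e);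
  hom_tgt : forall e, tgt (hom_edge e) = hom_vert (tgt e);
  hom_vact : forall g v, hom_vert (vact A g v) = vact B g (hom_vert v);
  hom_eact : forall g e, hom_edge (eact A g e) = eact B g (hom_edge e) }.

Program Definition rquiver_comp (k L : fieldType) (j : {rmorphism k -> L})
    (A B C : rquiver j) (g : rquiver_hom B C) (f : rquiver_hom A B) :
    rquiver_hom A C :=
  @RQuiverHom _ _ _ A C (hom_vert g \o hom_vert f) (hom_edge g \o hom_edge f)
    _ _ _ _.
Next Obligation. by move=> *; rewrite /= !hom_src. Qed.
Next Obligation. by move=> *; rewrite /= !hom_tgt. Qed.
Next Obligation. by move=> *; rewrite /= !hom_vact. Qed.
Next Obligation. by move=> *; rewrite /= !hom_eact. Qed.

Section BaseChangeRestriction.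
Variables (K : fieldType) (F : fieldExtType K) (L : fieldType).
Variable iota : {rmorphism F -> L}.

Local Notation incl := (@gal_incl _ _ _ iota).

Section BaseChange.
Implicit Types A B : rquiver (base_embedding iota).

Definition base_change A : rquiver iota := @RQuiver _ _ iota (rq_quiver A)
  (restrict_laction incl (vact A)) (restrict_laction incl (eact A))
  (restrict_continuous (@vact_continuous _ _ _ A))
  (restrict_continuous (@eact_continuous _ _ _ A))
  (fun g e => src_act (incl g) e) (fun g e => tgt_act (incl g) e).

Definition base_change_hom A B (f : rquiver_hom A B) :
    rquiver_hom (base_change A) (base_change B) :=
  @RQuiverHom _ _ _ (base_change A) (base_change B) (hom_vert f) (hom_edge f)
    (hom_src f) (hom_tgt f)
    (fun g v => hom_vact f (incl g) v) (fun g e => hom_eact f (incl g) e).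

End BaseChange.

Section Res.
Implicit Types A B : rquiver iota.

Definition Res_quiver A : quiver :=
  @Quiver (balanced_finType (vact A)) (balanced_finType (eact A))
    (balanced_map incl (eact A) (vact A) (@src A))
    (balanced_map incl (eact A) (vact A) (@tgt A)).

Definition Res A : rquiver (base_embedding iota) :=
  @RQuiver _ _ _ (Res_quiver A)
    (balanced_laction incl (vact A)) (balanced_laction incl (eact A))
    (balanced_continuous (@vact_continuous _ _ _ A))
    (balanced_continuous (@eact_continuous _ _ _ A))
    (balanced_map_act (@src_act _ _ _ A)) (balanced_map_act (@tgt_act _ _ _ A)).

Program Definition Res_hom A B (f : rquiver_hom A B) :
    rquiver_hom (Res A) (Res B) :=
  @RQuiverHom _ _ _ (Res A) (Res B)
    (balanced_map incl (vact A) (vact B) (hom_vert f))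
    (balanced_map incl (eact A) (eact B) (hom_edge f))
    _ _ (balanced_map_act (hom_vact f)) (balanced_map_act (hom_eact f)).
Next Obligation.
move=> A B f; elim/quotW => x /=.
have [sA sB] := (@src_act _ _ _ A, @src_act _ _ _ B).
have [fv fe] := (hom_vact f, hom_eact f).
by rewrite !balanced_mapE //= hom_src.
Qed.
Next Obligation.
move=> A B f; elim/quotW => x /=.
have [sA sB] := (@tgt_act _ _ _ A, @tgt_act _ _ _ B).
have [fv fe] := (hom_vact f, hom_eact f).
by rewrite !balanced_mapE //= hom_tgt.
Qed.

End Res.
End BaseChangeRestriction.

(* Main.v *)
Require Import Defs.
From mathcomp Require Import all_boot all_order all_algebra all_field.
From mathcomp Require Import boolp.

(** The statement is Frobenius reciprocity for induced sets, applied to the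
    vertices and to the edges at once.

    For a homomorphism of groups [i : H -> G] and an [H]-set [Y], the map
    [y |-> [1, y]] from [Y] to [G x_H Y] is the universal [H]-equivariant map
    from [Y] to a [G]-set. Indeed [[g, y] = g [1, y]], so a [G]-equivariant map
    on [G x_H Y] is determined by its values on the classes [[1, y]]
    ([balanced_equivariant_eq]); conversely an [H]-equivariant [f : Y -> Z]
    extends by [[g, y] |-> g f(y)], which the relation [(g h, y) ~ (g, h y)]
    respects precisely because [f] is equivariant ([balanced_liftE]).

    Source and target of [Res A] are the maps induced by those of [A], hence
    commute with [y |-> [1, y]]. So this map is a morphism of [F]-rational
    quivers from [A] to the base change of [Res A] ([Res_unit], the unit of the
    adjunction), and the extensions of the vertex and edge maps of a morphism
    form a morphism again ([Res_lift]). Extension and composition with the unit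
    are mutually inverse, and the naturality squares commute because both sides
    have the same values on the classes [[1, y]]. *)

Set Implicit Arguments.
Unset Strict Implicit.
Unset Printing Implicit Defensive.

Local Open Scope ring_scope.
Local Open Scope quotient_scope.

(** * Universal property of the balanced product *)

Section BalancedUniversal.
Variables (H G : groupType) (i : {multiplicative H -> G}).
Variables (Y : choiceType) (a : laction H Y).

Definition balanced_unit (y : Y) : balanced i a := \pi_(balanced i a) (1%g, y).

(** This is the relation [(h, y) ~ (1, h y)]. *)
Lemma balanced_unit_act h y :
  balanced_unit (a h y) = balanced_laction i a (i h) (balanced_unit y).
Proof.
rewrite /= balanced_actE mulg1; apply/esym/eqP/balancedP.
by exists h; rewrite /= mul1g.
Qed.

Lemma balanced_act_unit x :
  \pi_(balanced i a) x = balanced_laction i a x.1 (balanced_unit x.2).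
Proof. by case: x => g y; rewrite /= balanced_actE mulg1. Qed.

Lemma balanced_map_unit (Z : choiceType) (b : laction H Z) (f : Y -> Z) y :
  (forall h y, f (a h y) = b h (f y)) ->
  balanced_map i a b f (balanced_unit y) = \pi_(balanced i b) (1%g, f y).
Proof. by move=> fE; rewrite balanced_mapE. Qed.

Variables (Z : Type) (b : laction G Z).

(** The classes [[1, y]] generate the balanced product under [G]. *)
Lemma balanced_equivariant_eq (k k' : balanced i a -> Z) :
  (forall g q, k (balanced_laction i a g q) = b g (k q)) ->
  (forall g q, k' (balanced_laction i a g q) = b g (k' q)) ->
  k \o balanced_unit =1 k' \o balanced_unit -> k =1 k'.
Proof.
move=> kE k'E kk'; elim/quotW => x; rewrite balanced_act_unit kE k'E.
by congr (b _ _); exact: kk'.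
Qed.

Variable f : Y -> Z.

Definition balanced_lift (q : balanced i a) : Z := b (repr q).1 (f (repr q).2).

Hypothesis fE : forall h y, f (a h y) = b (i h) (f y).

(** Independence of the representative: [g h f(y) = g f(h y)]. *)
Lemma balanced_liftE x : balanced_lift (\pi_(balanced i a) x) = b x.1 (f x.2).
Proof.
rewrite /balanced_lift.
have /eqP/balancedP[h [-> ->]] := reprK (\pi_(balanced i a) x).
by rewrite fE lactM.
Qed.

Lemma balanced_lift_act g q :
  balanced_lift (balanced_laction i a g q) = b g (balanced_lift q).
Proof.
by elim/quotW: q => x; rewrite /= balanced_actE !balanced_liftE lactM.
Qed.

Lemma balanced_lift_unit y : balanced_lift (balanced_unit y) = f y.
Proof. by rewrite balanced_liftE lact1. Qed.

End BalancedUniversal.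

Arguments balanced_unit {H G} i {Y} a.
Arguments balanced_lift {H G} i {Y} a {Z} b f.

(** * The adjunction between restriction and base change *)

Lemma rquiver_hom_eq (k L : fieldType) (j : {rmorphism k -> L})
    (A B : rquiver j) (f g : rquiver_hom A B) :
  hom_vert f =1 hom_vert g -> hom_edge f =1 hom_edge g -> f = g.
Proof.
case: f g => [fv fe f1 f2 f3 f4] [gv ge g1 g2 g3 g4] /= /funext ev /funext ee.
case: _ / ev in g1 g2 g3 g4 *; case: _ / ee in g1 g2 g3 g4 *.
by congr RQuiverHom; exact: Prop_irrelevance.
Qed.

Section Adjunction.
Variables (K : fieldType) (F : fieldExtType K) (L : fieldType).
Variable iota : {rmorphism F -> L}.

Local Notation incl := (@gal_incl _ _ _ iota).

Section Unit.
Variable A : rquiver iota.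

Lemma Res_src_unit e : src (q := Res A) (balanced_unit incl (eact A) e) =
  balanced_unit incl (vact A) (src e).
Proof. exact: (balanced_map_unit _ _ (@src_act _ _ _ A)). Qed.

Lemma Res_tgt_unit e : tgt (q := Res A) (balanced_unit incl (eact A) e) =
  balanced_unit incl (vact A) (tgt e).
Proof. exact: (balanced_map_unit _ _ (@tgt_act _ _ _ A)). Qed.

Definition Res_unit : rquiver_hom A (base_change (Res A)) :=
  @RQuiverHom _ _ _ A (base_change (Res A))
    (balanced_unit incl (vact A)) (balanced_unit incl (eact A))
    Res_src_unit Res_tgt_unit
    (balanced_unit_act incl (vact A)) (balanced_unit_act incl (eact A)).

End Unit.

Section Lift.
Variables (A : rquiver iota) (B : rquiver (base_embedding iota)).

(** Uniqueness half of the universal property; both naturality squares are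
    proved by comparing restrictions along the unit through it. *)
Lemma Res_hom_eq (k k' : rquiver_hom (Res A) B) :
  rquiver_comp (base_change_hom k) (Res_unit A) =
  rquiver_comp (base_change_hom k') (Res_unit A) -> k = k'.
Proof.
move=> kk'; apply: rquiver_hom_eq.
- apply: (balanced_equivariant_eq (hom_vact k) (hom_vact k')) => v.
  exact: (congr1 (fun u => hom_vert u v) kk').
- apply: (balanced_equivariant_eq (hom_eact k) (hom_eact k')) => e.
  exact: (congr1 (fun u => hom_edge u e) kk').
Qed.

Variable u : rquiver_hom A (base_change B).

Let lift_vert : vert (Res A) -> vert B :=
  balanced_lift incl (vact A) (vact B) (hom_vert u).
Let lift_edge : edge (Res A) -> edge B :=
  balanced_lift incl (eact A) (eact B) (hom_edge u).

Let lift_vert_act g (v : vert (Res A)) :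
  lift_vert (vact (Res A) g v) = vact B g (lift_vert v).
Proof. exact: (balanced_lift_act (hom_vact u)). Qed.

Let lift_edge_act g (e : edge (Res A)) :
  lift_edge (eact (Res A) g e) = eact B g (lift_edge e).
Proof. exact: (balanced_lift_act (hom_eact u)). Qed.

(* Both sides are equivariant in the edge, so the classes [1, e] suffice. *)
Let lift_src (e : edge (Res A)) : src (lift_edge e) = lift_vert (src e).
Proof.
move: e; apply: (@balanced_equivariant_eq _ _ _ _ _ _ (vact B)) => [g q|g q|e].
- by rewrite -src_act -lift_edge_act.
- by rewrite -lift_vert_act -src_act.
- transitivity (src (hom_edge u e)).
    by congr src; exact: (balanced_lift_unit (hom_eact u)).
  apply: etrans (hom_src u e) _; apply: esym.
  apply: etrans (congr1 lift_vert (Res_src_unit e)) _.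
  exact: (balanced_lift_unit (hom_vact u)).
Qed.

Let lift_tgt (e : edge (Res A)) : tgt (lift_edge e) = lift_vert (tgt e).
Proof.
move: e; apply: (@balanced_equivariant_eq _ _ _ _ _ _ (vact B)) => [g q|g q|e].
- by rewrite -tgt_act -lift_edge_act.
- by rewrite -lift_vert_act -tgt_act.
- transitivity (tgt (hom_edge u e)).
    by congr tgt; exact: (balanced_lift_unit (hom_eact u)).
  apply: etrans (hom_tgt u e) _; apply: esym.
  apply: etrans (congr1 lift_vert (Res_tgt_unit e)) _.
  exact: (balanced_lift_unit (hom_vact u)).
Qed.

Definition Res_lift : rquiver_hom (Res A) B :=
  @RQuiverHom _ _ _ (Res A) B lift_vert lift_edge
    lift_src lift_tgt lift_vert_act lift_edge_act.

Lemma Res_lift_unit : rquiver_comp (base_change_hom Res_lift) (Res_unit A) = u.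
Proof.
apply: rquiver_hom_eq => [v|e].
- exact: (balanced_lift_unit (hom_vact u)).
- exact: (balanced_lift_unit (hom_eact u)).
Qed.

End Lift.

Lemma Res_unit_natural (A A' : rquiver iota) (f : rquiver_hom A' A) :
  rquiver_comp (base_change_hom (Res_hom f)) (Res_unit A') =
  rquiver_comp (Res_unit A) f.
Proof.
apply: rquiver_hom_eq => [v|e].
- exact: (balanced_map_unit _ _ (hom_vact f)).
- exact: (balanced_map_unit _ _ (hom_eact f)).
Qed.

End Adjunction.

Lemma rquiver_compA (k L : fieldType) (j : {rmorphism k -> L})
    (A B C D : rquiver j)
    (h : rquiver_hom C D) (g : rquiver_hom B C) (f : rquiver_hom A B) :
  rquiver_comp h (rquiver_comp g f) = rquiver_comp (rquiver_comp h g) f.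
Proof. exact: rquiver_hom_eq. Qed.

Lemma base_change_comp (K : fieldType) (F : fieldExtType K) (L : fieldType)
    (iota : {rmorphism F -> L}) (A B C : rquiver (base_embedding iota))
    (g : rquiver_hom B C) (f : rquiver_hom A B) :
  base_change_hom (rquiver_comp g f) =
  rquiver_comp (base_change_hom g) (base_change_hom f).
Proof. exact: rquiver_hom_eq. Qed.

Theorem proposition1p13 (K : fieldType) (F : fieldExtType K) (L : fieldType)
    (iota : {rmorphism F -> L}) (galLK : galois_ext (base_embedding iota)) :
  exists phi : forall (A : rquiver iota) (B : rquiver (base_embedding iota)),
      rquiver_hom A (base_change B) -> rquiver_hom (Res A) B,
    [/\ forall A B, bijective (phi A B),
        forall A A' B (f : rquiver_hom A' A) (u : rquiver_hom A (base_change B)),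
          phi A' B (rquiver_comp u f) = rquiver_comp (phi A B u) (Res_hom f)
      & forall A B B' (g : rquiver_hom B B') (u : rquiver_hom A (base_change B)),
          phi A B' (rquiver_comp (base_change_hom g) u) =
          rquiver_comp g (phi A B u)].
Proof.
exists (@Res_lift K F L iota); split.
- move=> A B.
  exists (fun k => rquiver_comp (base_change_hom k) (Res_unit A)) => [u|k].
    exact: Res_lift_unit.
  by apply: Res_hom_eq; rewrite Res_lift_unit.
- move=> A A' B f u; apply: Res_hom_eq.
  rewrite base_change_comp -rquiver_compA Res_unit_natural rquiver_compA.
  by rewrite !Res_lift_unit.
- move=> A B B' g u; apply: Res_hom_eq.
  by rewrite base_change_comp -rquiver_compA !Res_lift_unit.
Qed.
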